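(* Let $A$ and $B$ be finite abelian groups, with $B$ acting on $A$ by automorphisms. Then the semidirect product $A\rtimes B$ is totally unramified.
   Context: All representations are complex. A representation is multiplicity free if it is a direct sum of pairwise non-equivalent irreducible representations; a restriction $\rho|_N$ is called trivial if every element of $N$ acts as the identity. A finite group $G$ is unramified over a nontrivial abelian normal subgroup $N$ if for every irreducible representation $\rho$ of $G$ the restriction $\rho|_N$ is multiplicity free or trivial. A finite group $G$ is totally unramified (recursively) if it is abelian or there exists a nontrivial abelian normal subgroup $N$ such that $G$ is unramified over $N$ and $G/N$ is totally unramified. *)

(* Defs.v *)
From HB Require Import structures.
From mathcomp Require Import all_boot all_order all_algebra all_fingroup.
From mathcomp Require Import all_solvable mxrepresentation.
From mathcomp Require Import reals complex.

Set Implicit Arguments.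
Unset Strict Implicit.
Unset Printing Implicit Defensive.

Import GroupScope GRing.Theory.
Local Open Scope ring_scope.

(* Representations are taken over R[i], the complex numbers over a model R    *)
(* of the real numbers. Irreducible (mx_irreducible, mxsimple) entails being  *)
(* nonzero; mx_iso is equivalence of submodules of a representation.          *)

Definition multiplicity_free (R : realType) (gT : finGroupType)
    (G : {group gT}) (n : nat) (rG : mx_representation R[i] G n) : Prop :=
  exists (k : nat) (W : 'I_k -> 'M[R[i]]_n),
    [/\ forall i, mxsimple rG (W i),
        (\sum_i W i :=: 1%:M)%MS,
        mxdirect (\sum_i W i)%MS
      & forall i j, i != j -> ~ mx_iso rG (W i) (W j)].

Definition trivial_repr (R : realType) (gT : finGroupType)
    (G : {group gT}) (n : nat) (rG : mx_representation R[i] G n) : Prop :=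
  forall x, x \in G -> rG x = 1%:M.

Definition unramified_over (R : realType) (gT : finGroupType)
    (G N : {group gT}) (sNG : N \subset G) : Prop :=
  forall (n : nat) (rG : mx_representation R[i] G n),
    mx_irreducible rG ->
    multiplicity_free (subg_repr rG sNG) \/ trivial_repr (subg_repr rG sNG).

(* The ambient type and the group are non-uniform parameters: the quotient    *)
(* G / N is a group of elements of type coset_of N.                           *)
Inductive totally_unramified (R : realType) (gT : finGroupType)
    (G : {group gT}) : Prop :=
  | TotallyUnramifiedAbelian of abelian G
  | TotallyUnramifiedStep (N : {group gT}) (nsNG : N <| G) of
      abelian N & N :!=: 1%g & unramified_over R (normal_sub nsNG)
      & totally_unramified R (G / N)%G.

(* Main.v *)
(* The choice N = A works. Let V be an irreducible representation of
   G = A ><| B and chi a character of A occurring in V, with weight space V_chi.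
   The stabiliser T of V_chi in B is abelian, so it has an eigenvector v in
   V_chi. The lines spanned by the v x, x in G, span V by irreducibility, and
   each of them is A-stable. If v x and v y have the same weight, then x y^-1
   fixes chi, hence lies in A T, so v x and v y span the same line: distinct
   lines carry distinct characters of A. *)
Require Import Defs.
From HB Require Import structures.
From mathcomp Require Import all_boot all_order all_algebra all_fingroup.
From mathcomp Require Import all_solvable mxrepresentation.
From mathcomp Require Import boolp reals complex.

Set Implicit Arguments.
Unset Strict Implicit.
Unset Printing Implicit Defensive.

Import GroupScope GRing.Theory.
Local Open Scope ring_scope.

(** Over an algebraically closed field a simple module of an abelian group is a line, so any nonzero
    row of a simple submodule of [U] is a common eigenvector. *)
Lemma abelian_weight_vector (F : closedFieldType) (gT : finGroupType)
    (H : {group gT}) (n m : nat) (rH : mx_representation F H n)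
    (U : 'M_(m, n)) :
  abelian H -> mxmodule rH U -> U != 0 ->
  exists v : 'rV_n, exists chi : gT -> F,
    [/\ v != 0, (v <= U)%MS & forall x, x \in H -> v *m rH x = chi x *: v].
Proof.
move=> abH modU nzU; apply: contrapT => noV.
(* [mxsimple_exists] provides its submodule only under [classically], hence the detour through
   [false]. *)
suff: false by []; apply: (mxsimple_exists modU nzU) => -[M simM sMU].
case: noV; have [modM nzM _] := simM.
have rM : \rank M = 1%N.
  by apply: mxsimple_abelian_linear simM => //; apply: group_closure_closed_field.
have nzv : nz_row M != 0 by rewrite nz_row_eq0.
have defM : (nz_row M :=: M)%MS.
  apply/eqmxP; rewrite nz_row_sub /= -(geq_leqif (mxrank_leqif_sup _)) ?nz_row_sub //.
  by rewrite rM lt0n mxrank_eq0.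
exists (nz_row M), (fun x => (nz_row M *m rH x *m pinvmx (nz_row M)) 0 0).
split=> // [|x Hx]; first exact: submx_trans (nz_row_sub M) sMU.
rewrite -mul_scalar_mx -mx11_scalar mulmxKpV //.
by rewrite -(eqmxMr _ (eqmx_sym defM)) defM (mxmoduleP modM).
Qed.

Lemma scaled_row_sub (F : fieldType) (n : nat) (u v : 'rV[F]_n) (c : F) :
  u != 0 -> u = c *: v -> (v <= u)%MS.
Proof.
move=> nzu def_u; have nzc : c != 0.
  by apply: contraNneq nzu => c0; rewrite def_u c0 scale0r.
by rewrite def_u (eqmx_scale _ nzc).
Qed.

(** An isomorphism commutes with [rH a], so it carries the eigenvalue [c] over to its nonzero image
    [V]. *)
Lemma mx_iso_weight (F : fieldType) (gT : finGroupType) (H : {group gT})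
    (n : nat) (rH : mx_representation F H n) (U V : 'M_n) (a : gT) (c d : F) :
  a \in H -> V != 0 -> U *m rH a = c *: U -> V *m rH a = d *: V ->
  mx_iso rH U V -> c = d.
Proof.
move=> Ha nzV Ua Va [f _ /hom_mxP homU defV].
have /submxP[D defV'] : (V <= U *m f)%MS by rewrite defV.
have: c *: V = d *: V.
  by rewrite -Va defV' -mulmxA -homU // Ua -scalemxAl -scalemxAr.
by move/eqP; rewrite -subr_eq0 -scalerBl scaler_eq0 (negPf nzV) orbF subr_eq0 => /eqP.
Qed.

Lemma restriction_multiplicity_free (R : realType) (gT : finGroupType)
    (G A B : {group gT}) (sAG : A \subset G) (n : nat)
    (rG : mx_representation R[i] G n) :
  A ><| B = G -> abelian A -> abelian B -> mx_irreducible rG ->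
  multiplicity_free (subg_repr rG sAG).
Proof.
move=> /sdprodP[_ defG nAB _] abA abB irrG.
have [_ nz1 minG] := irrG.
have sBG : B \subset G by rewrite -defG mulG_subr.
have nAG : G \subset 'N(A) by rewrite -defG mul_subG ?normG.
have AG a : a \in A -> a \in G by apply: (subsetP sAG).
have BG b : b \in B -> b \in G by apply: (subsetP sBG).
have AJ a x : x \in G -> a \in A -> (a ^ x)%g \in A.
  by move=> Gx Aa; rewrite memJ_norm // (subsetP nAG).
set rA := subg_repr rG sAG.
have [v0 [chi [nzv0 _ v0A]]] :=
  abelian_weight_vector abA (mxmodule1 rA) nz1.
pose V := (\bigcap_(a in A) eigenspace (rG a) (chi a))%MS.
have VP m (u : 'M_(m, n)) :
    reflect (forall a, a \in A -> u *m rG a = chi a *: u) (u <= V)%MS.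
  apply: (iffP sub_bigcapmxP) => uA a Aa; first exact/eigenspaceP/uA.
  by apply/eigenspaceP/uA.
have nzV : V != 0.
  apply: contraNneq nzv0 => V0; rewrite -submx0 -V0; exact/VP.
pose T := [group of B :&: rstabs rG V].
have sTG : T \subset G by rewrite subIset ?sBG.
have abT : abelian T by apply: abelianS abB; apply: subsetIl.
have modVT : mxmodule (subg_repr rG sTG) V.
  by apply/mxmoduleP => t /setIP[_ /setIdP[]].
have [v [psi [nzv /VP vA vT]]] := abelian_weight_vector abT modVT nzV.
(* Since [x a = (x a x^-1) x], translating [v] by [x] conjugates its weight. *)
have vJA x a : x \in G -> a \in A ->
    v *m rG x *m rG a = chi (a ^ x^-1)%g *: (v *m rG x).
  move=> Gx Aa; have Ga := AG _ Aa; have Gxi : (x^-1)%g \in G by rewrite groupV.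
  rewrite -mulmxA -repr_mxM // conjgCV repr_mxM ?groupJ //.
  by rewrite mulmxA vA ?AJ // -scalemxAl.
have nzvx x : x \in G -> v *m rG x != 0.
  move=> Gx; apply: contraNneq nzv => vx0.
  by rewrite -[v](repr_mxK rG Gx) vx0 mul0mx.
pose W (x : subg_of G) : 'M[R[i]]_n := <<v *m rG (sgval x)>>%MS.
have nzW x : W x != 0.
  by rewrite (eqmx_eq0 (genmxE _)) nzvx ?subgP.
have WA x a : a \in A -> W x *m rA a = chi (a ^ (sgval x)^-1)%g *: W x.
  move=> Aa; have /submxP[D ->] : (W x <= v *m rG (sgval x))%MS by rewrite genmxE.
  by rewrite -mulmxA vJA ?subgP // -scalemxAr.
have simW x : mxsimple rA (W x).
  apply: linear_mxsimple.
    by apply/mxmoduleP => a Aa; rewrite WA // scalemx_sub.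
  by rewrite genmxE rank_rV nzvx ?subgP.
have sumW : (\sum_x W x :=: 1%:M)%MS.
  (* Right multiplication by [g] permutes the lines, so their nonzero sum is [G]-stable, hence
     everything. *)
  apply/eqmxP; rewrite submx1 /= minG ?submx1 //.
    apply/mxmoduleP => g Gg; rewrite sumsmxMr; apply/sumsmx_subP => x _.
    rewrite (sumsmx_sup (x * subg G g)%g) // (eqmxMr _ (genmxE _)) genmxE.
    by rewrite -mulmxA /= subgK // repr_mxM ?subgP.
  apply/eqP => S0; have /eqP := nzW 1%g; apply.
  by apply/eqP; rewrite -submx0 -S0 (sumsmx_sup 1%g).
have isoW x y : mx_iso rA (W x) (W y) -> (W x <= W y)%MS.
  case: x y => [x Gx] [y Gy] iso; pose z := (x * y^-1)%g.
  have Gz : z \in G by rewrite groupM ?groupV.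
  have chiz a : a \in A -> chi (a ^ z^-1)%g = chi a.
    (* The weights are compared at [a ^ y]: there that of [W y] is [chi a] and that of [W x] is
       [chi (a ^ z^-1)]. *)
    move=> Aa; have Aay := AJ _ _ Gy Aa.
    have := mx_iso_weight Aay (nzW _) (WA _ _ Aay) (WA _ _ Aay) iso.
    by rewrite /= conjgK invMg invgK conjgM.
  have /mulsgP[a t Aa Bt defz] : z \in (A * B)%g by rewrite defG.
  have Gt := BG _ Bt; have Ga := AG _ Aa.
  (* Conjugation by [a] is trivial on the abelian group [A], so [t] fixes [chi] because [z] does. *)
  have chit c : c \in A -> chi (c ^ t^-1)%g = chi c.
    move=> Ac; rewrite -[RHS]chiz // defz invMg conjgM; set d := (c ^ t^-1)%g.
    have Ad : d \in A by rewrite AJ ?groupV.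
    by rewrite conjgE (centsP abA d Ad) ?groupV // mulKg.
  have Tt : t \in T.
    rewrite inE Bt inE Gt /=; apply/VP => c Ac; have Gc := AG _ Ac.
    rewrite -mulmxA -repr_mxM // conjgCV repr_mxM ?groupJ ?groupV // mulmxA.
    by have /VP-> := submx_refl V; rewrite ?AJ ?groupV // -scalemxAl chit.
  (* As [v] is an eigenvector of both [a] and [t], [v x] is a multiple of [v y]. *)
  rewrite !genmxE /=; have -> : x = (a * t * y)%g by rewrite -defz mulgKV.
  rewrite !repr_mxM ?groupM // !mulmxA vA // -!scalemxAl vT // -scalemxAl.
  by rewrite !scalemx_sub.
(* Different [x] may give the same line; [J] selects a direct subfamily with the same sum. *)
have [J /= [sumJ dxJ]] := sum_mxsimple_direct_sub simW sumW.
exists #|J|, (fun i => W (enum_val i)); split=> [i|||i j neq_ij iso].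
- exact: simW.
- by rewrite -(big_enum_val W).
- by apply/mxdirectP; rewrite /= -(big_enum_val W) (mxdirectP dxJ) /=
    (big_enum_val (fun x => \rank (W x))).
(* By [isoW], isomorphic lines at distinct indices of [J] would put one inside the sum of the
   others, against directness. *)
have /mxdirect_sumsP/(_ _ (enum_valP i)) cap0 := dxJ.
have /eqP := nzW (enum_val i); apply; apply/eqP; rewrite -submx0 -cap0.
rewrite sub_capmx submx_refl (sumsmx_sup (enum_val j)) ?isoW //.
by rewrite enum_valP (inj_eq enum_val_inj) eq_sym.
Qed.

Lemma sdprod_abelian_totally_unramified (R : realType) (gT : finGroupType)
    (G A B : {group gT}) :
  A ><| B = G -> abelian A -> abelian B -> totally_unramified R G.
Proof.
move=> defG abA abB; have [nsAG sBG _ _ _] := sdprod_context defG.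
(* [A] qualifies as [N] only if nontrivial; otherwise [G] is [B]. In the main case [G / A] is an
   image of [B], so one step suffices. *)
have [A1 | ntA] := eqVneq (A : {set gT}) 1%g.
  apply: TotallyUnramifiedAbelian.
  by move: defG; rewrite A1 sdprod1g => <-.
apply: (@TotallyUnramifiedStep _ _ _ A nsAG) => // [n rG irrG|].
  by left; apply: restriction_multiplicity_free defG _ _ irrG.
apply: TotallyUnramifiedAbelian.
by have [_ /= <- _ _] := sdprodP defG; rewrite quotientMidl quotient_abelian.
Qed.

Theorem corollary5p12 (R : realType) (aT rT : finGroupType)
    (B : {group aT}) (A : {group rT}) (to : groupAction B A) :
  abelian A -> abelian B ->
  totally_unramified R [set: sdprod_by to]%G.
Proof.
(* The external product is the internal one of the embedded copies of [A] and [B]. *)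
move=> abA abB; apply: (sdprod_abelian_totally_unramified R (sdprod_sdpair to)).
  exact: morphim_abelian.
exact: morphim_abelian.
Qed.
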